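(* Let $(X_1,d_1,a)$ and $(X_2,d_2,b)$ be two O-metric spaces, $f:X_1\to X_2$ a map, and $\tilde{x}\in X_1$. The following are equivalent: (i) $f$ is sequentially continuous at $\tilde{x}$, i.e. for any sequence $\{x_n\}_{n\in\mathbb{N}}$ of points in $X_1$, $x_n\to\tilde{x}\implies f(x_n)\to f(\tilde{x})$; (ii) for all $\epsilon>0$ there exists $\delta>0$ such that, for $x\in X_1$, $|d_1(x,\tilde{x})-a|<\delta\implies|d_2(f(x),f(\tilde{x}))-b|<\epsilon$.
   Context: $\mathbb{R}_+=[0,\infty)$. Let $X$ be a non-empty set, $a\in\mathbb{R}_+$, $I_a\subset\mathbb{R}_+$ an interval containing $a$, and $\mathbf{o}:I_a\times I_a\to\mathbb{R}_+$ a function. A function $d:X\times X\to I_a$ is an O-metric on $X$, and $(X,d,a)$ is an O-metric space, if for all $x,y,z\in X$: (i) $d(x,y)=a$ if and only if $x=y$; (ii) $d(x,y)=d(y,x)$; (iii) $d(x,z)\le \mathbf{o}(d(x,y),d(y,z))$. A sequence $\{x_n\}$ in an O-metric space $(X,d,a)$ converges to $x\in X$, written $x_n\to x$, if and only if $\lim_{n\to\infty}d(x_n,x)=a$. *)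

(* Defs.v *)
From mathcomp Require Import all_boot all_order all_algebra.
From mathcomp Require Import all_classical all_reals all_analysis.
Set Implicit Arguments.
Unset Strict Implicit.
Unset Printing Implicit Defensive.
Import Order.TTheory GRing.Theory Num.Theory.
Import numFieldNormedType.Exports.
Local Open Scope classical_set_scope.
Local Open Scope ring_scope.

(* The functions [o : I x I -> R_+] and [d : X x X -> I] are represented by
   total [R]-valued functions together with the fields [O_range] and
   [dist_range]; the values of [o] outside [I x I] are never used. *)
Record is_O_metric_space (R : realType) (X : Type) (a : R) (I : set R)
    (o : R -> R -> R) (d : X -> X -> R) : Prop := IsOMetricSpace {
  space_nonempty : [set: X] !=set0 ;
  base_interval : is_interval I ;
  base_nonneg : I `<=` [set t | 0 <= t] ;
  base_mem : I a ;
  O_range : forall u v, I u -> I v -> 0 <= o u v ;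
  dist_range : forall x y, I (d x y) ;
  dist_eq : forall x y, d x y = a <-> x = y ;
  dist_sym : forall x y, d x y = d y x ;
  dist_triangle : forall x y z, d x z <= o (d x y) (d y z)
}.

Definition O_converges (R : realType) (X : Type) (d : X -> X -> R) (a : R)
    (u : nat -> X) (x : X) : Prop :=
  d (u n) x @[n --> \oo] --> a.

Definition O_seq_continuous_at (R : realType) (X1 X2 : Type)
    (d1 : X1 -> X1 -> R) (a : R) (d2 : X2 -> X2 -> R) (b : R)
    (f : X1 -> X2) (x0 : X1) : Prop :=
  forall u : nat -> X1,
    O_converges d1 a u x0 -> O_converges d2 b (fun n => f (u n)) (f x0).

(* Main.v *)
Require Import Defs.
From mathcomp Require Import all_boot all_order all_algebra.
From mathcomp Require Import all_classical all_reals all_analysis.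
Import Order.TTheory GRing.Theory Num.Theory.
Import numFieldNormedType.Exports.
Local Open Scope classical_set_scope.
Local Open Scope ring_scope.

(** Convergence in an O-metric space is convergence of real distances to the base value, so the
    classical metric argument carries over. A [delta] for [e] controls every tail of a convergent
    sequence. Conversely, if some [e] admits no [delta], choosing a counterexample for each
    [harmonic n] yields a sequence converging to [x0] whose image stays [e]-far from the limit. *)

Theorem proposition2p24 (R : realType)
    (X1 : Type) (a : R) (I1 : set R) (o1 : R -> R -> R) (d1 : X1 -> X1 -> R)
    (X2 : Type) (b : R) (I2 : set R) (o2 : R -> R -> R) (d2 : X2 -> X2 -> R)
    (h1 : is_O_metric_space a I1 o1 d1) (h2 : is_O_metric_space b I2 o2 d2)
    (f : X1 -> X2) (x0 : X1) :
  O_seq_continuous_at d1 a d2 b f x0 <->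
  (forall e : R, 0 < e -> exists2 delta : R, 0 < delta &
     forall x : X1, `|d1 x x0 - a| < delta -> `|d2 (f x) (f x0) - b| < e).
Proof.
split=> [fx0 e e0|fx0 u /cvgrPdistC_lt ux0]; last first.
  apply/cvgrPdistC_lt => e /fx0[delta delta0 hdelta].
  by near=> n; apply: hdelta; near: n; exact: ux0.
apply: contrapT => nodelta.
(* [harmonic n] is 1/(n+1), positive even at [n = 0], hence a legitimate candidate for [delta]. *)
have bad n : exists x, `|d1 x x0 - a| < harmonic n /\ e <= `|d2 (f x) (f x0) - b|.
  apply: contrapT => /forallNP nobad; apply: nodelta.
  exists (harmonic n) => [|x xn]; first exact: harmonic_gt0.
  by rewrite ltNge; apply/negP => ex; exact: (nobad x).
have [u /all_and2[u_close u_far]] := choice bad.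
have ux0 : O_converges d1 a u x0.
  apply/cvgrPdistC_lt => r r0; near=> n; apply: lt_trans (u_close n) _.
  by near: n; exact: (cvgr_lt _ (@cvg_harmonic R)).
(* A single index is enough: at [N] itself the image is [e]-close, against [u_far]. *)
have /cvgrPdistC_lt/(_ e e0)[N _ /(_ N (leqnn N))] := fx0 u ux0.
by rewrite /= ltNge u_far.
Unshelve. all: by end_near. Qed.
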